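(* Let $f,g:U\subset\mathbb{R}^2\to\mathbb{R}$ be smooth functions on an open set $U$ such that the graph $$M=\{(x,y,f(x,y),g(x,y))\in\mathbb{R}^{3,1}\mid (x,y)\in U\}$$ is a spacelike surface, with parametrization $\psi(x,y)=(x,y,f(x,y),g(x,y))$ and $E=\langle\psi_x,\psi_x\rangle$, $F=\langle\psi_x,\psi_y\rangle$, $G=\langle\psi_y,\psi_y\rangle$. Then $M$ has a canonical normal null direction with respect to $e_1=(1,0,0,0)$ if and only if $EG-F^2=G$ on $U$. In this case, $$e_1^\top=\psi_x-\frac{F}{G}\psi_y.$$
   Context: $\mathbb{R}^{3,1}$ is $\mathbb{R}^4$ with the metric $\langle\cdot,\cdot\rangle=dx_1^2+dx_2^2+dx_3^2-dx_4^2$. A surface is spacelike if its induced metric is Riemannian. Explicitly $E=1+f_x^2-g_x^2$, $F=f_xf_y-g_xg_y$, $G=1+f_y^2-g_y^2$. $e_1=e_1^\top+e_1^\perp$ is the decomposition of the constant vector field $e_1$ into tangent and normal parts along $M$; $M$ has a canonical normal null direction with respect to $e_1$ if $e_1^\perp$ is a lightlike normal vector field along $M$ (nonzero with $\langle e_1^\perp,e_1^\perp\rangle=0$).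
   Formalization: The ''if'' direction (EG−F²=G implies a canonical normal null direction) is stated under the extra assumption that e_1 is nowhere tangent to M; without it the claim fails, e.g. for f=g=0, where EG−F²=G but e_1^⊥=0 is not lightlike. *)

(* Defs.v *)
From HB Require Import structures.
From mathcomp Require Import all_boot all_order all_algebra.
From mathcomp Require Import all_classical all_reals all_analysis.
Set Implicit Arguments.
Unset Strict Implicit.
Unset Printing Implicit Defensive.
Import Order.TTheory GRing.Theory Num.Theory.
Import numFieldNormedType.Exports.
Local Open Scope classical_set_scope.
Local Open Scope ring_scope.

Definition dx {R : realType} {V : normedModType R} (h : R * R -> V) :
  R * R -> V := fun p => 'D_((1 : R), (0 : R)) h p.

Definition dy {R : realType} {V : normedModType R} (h : R * R -> V) :
  R * R -> V := fun p => 'D_((0 : R), (1 : R)) h p.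

Fixpoint Ck {R : realType} (k : nat) (U : set (R * R)) (h : R * R -> R) : Prop :=
  match k with
  | 0%N => forall p, U p -> {for p, continuous h}
  | k'.+1 =>
      [/\ forall p, U p -> {for p, continuous h},
          forall p, U p -> derivable h p ((1 : R), (0 : R)),
          forall p, U p -> derivable h p ((0 : R), (1 : R)),
          Ck k' U (dx h) & Ck k' U (dy h)]
  end.

(* Functions on an open set U are represented by total functions; neither
   smoothness on U nor the derivatives at points of U depend on the values
   outside U. *)
Definition smooth_on {R : realType} (U : set (R * R)) (h : R * R -> R) : Prop :=
  forall k, Ck k U h.

(* Elements of 'rV[R]_4; the coordinates x_1, ..., x_4 have indices 0, ..., 3. *)
Definition mink {R : realType} (v w : 'rV[R]_4) : R :=
  v 0 0 * w 0 0 + v 0 1 * w 0 1 + v 0 2 * w 0 2 - v 0 3 * w 0 3.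

Definition vec4 {R : realType} (a b c d : R) : 'rV[R]_4 :=
  \row_(i < 4) [:: a; b; c; d]`_i.

Definition e1 {R : realType} : 'rV[R]_4 := vec4 1 0 0 0.

Definition graph_param {R : realType} (f g : R * R -> R) : R * R -> 'rV[R]_4 :=
  fun p => vec4 p.1 p.2 (f p) (g p).

Section ParametrizedSurface.
Context {R : realType}.
Implicit Types (U : set (R * R)) (psi : R * R -> 'rV[R]_4) (p : R * R).
Implicit Types (v w : 'rV[R]_4).

Definition tangent psi p w : Prop :=
  exists a b : R, w = a *: dx psi p + b *: dy psi p.

Definition normal psi p w : Prop :=
  forall t, tangent psi p t -> mink w t = 0.

Definition spacelike U psi : Prop :=
  forall p, U p -> forall w, tangent psi p w -> w != 0 -> 0 < mink w w.

Definition fundE psi p : R := mink (dx psi p) (dx psi p).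
Definition fundF psi p : R := mink (dx psi p) (dy psi p).
Definition fundG psi p : R := mink (dy psi p) (dy psi p).

(* The decomposition v = v^T + v^perp exists and is unique where the tangent
   plane is nondegenerate, in particular on spacelike surfaces; elsewhere the
   choice made by xget is irrelevant. *)
Definition tangent_part psi v p : 'rV[R]_4 :=
  xget 0 [set w | tangent psi p w /\ normal psi p (v - w)].

Definition normal_part psi v p : 'rV[R]_4 := v - tangent_part psi v p.

Definition lightlike w : Prop := w <> 0 /\ mink w w = 0.

Definition canonical_normal_null_direction U psi v : Prop :=
  forall p, U p -> lightlike (normal_part psi v p).

End ParametrizedSurface.

(* Main.v *)
Require Import Defs.
From HB Require Import structures.
From mathcomp Require Import all_boot all_order all_algebra.
From mathcomp Require Import all_classical all_reals all_analysis.
From mathcomp Require Import ring.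
Import Order.TTheory GRing.Theory Num.Theory.
Import numFieldNormedType.Exports.
Local Open Scope classical_set_scope.
Local Open Scope ring_scope.

(** Because [e1] is constant with [<e1, e1> = 1] and the first coordinate of
    a graph is [x], the products of [e1] with the coordinate frame are
    [<e1, psi_x> = 1] and [<e1, psi_y> = 0].  Orthogonality of [e1 - e1^T] to
    the frame is therefore a linear system for the coefficients of [e1^T], with
    matrix the Gram matrix of the frame.  A spacelike tangent plane makes that
    matrix positive definite, and Cramer's rule gives
    [e1^T = (G psi_x - F psi_y) / (E G - F^2)] ([tangent_part_e1]).

    Since [e1^perp] is orthogonal to [e1^T], its square is
    [<e1^perp, e1> = 1 - G / (E G - F^2)] ([normal_part_e1_sqr]), which vanishes
    exactly when [E G - F^2 = G]; under this condition the formula for [e1^T]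
    reads [psi_x - (F / G) psi_y].  The other half of being lightlike,
    [e1^perp <> 0], says that [e1] is not tangent. *)

(** * Directional derivatives of linear maps *)

Section LinearDerivative.
Set Implicit Arguments.
Unset Strict Implicit.
Context {R : realType} {V W : normedModType R}.

(** The difference quotients of a linear map are constant, so its directional
    derivatives exist without any continuity assumption. *)
Lemma is_derive_linear (L : V -> W) (p v : V) :
  linear L -> is_derive p v L (L v).
Proof.
move=> L_linear.
have quot_cvg :
    (fun h : R => h^-1 *: ((L \o shift p) (h *: v) - L p)) @ 0^' --> L v.
  apply: cvg_near_cst.
  near=> h.
  have h_neq0 : h != 0 by near: h; exact: nbhs_dnbhs_neq.
  by rewrite /= L_linear addrK scalerA mulVf// scale1r.
apply: DeriveDef; first by apply/cvg_ex; exists (L v).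
exact: cvg_lim quot_cvg.
Unshelve. all: by end_near. Qed.

End LinearDerivative.

(** * Bilinear algebra of the Minkowski product *)

Section Minkowski.
Context {R : realType}.
Implicit Types (u v w : 'rV[R]_4) (a b c d : R).

Lemma minkC v w : mink v w = mink w v.
Proof. by rewrite /mink; ring. Qed.

Lemma minkBl v w u : mink (v - w) u = mink v u - mink w u.
Proof. by rewrite /mink !mxE; ring. Qed.

Lemma mink_combl a b v w u :
  mink (a *: v + b *: w) u = a * mink v u + b * mink w u.
Proof. by rewrite /mink !mxE; ring. Qed.

Lemma mink_combr a b v w u :
  mink u (a *: v + b *: w) = a * mink u v + b * mink u w.
Proof. by rewrite minkC mink_combl !(minkC u). Qed.

(** The vector [<w, w> v - <v, w> w] is the component of [<w, w> v] orthogonal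
    to [w], so its square is [<w, w>] times the Gram determinant of [v, w]. *)
Lemma mink_gram v w :
  mink (mink w w *: v + - mink v w *: w) (mink w w *: v + - mink v w *: w) =
  mink w w * (mink v v * mink w w - mink v w ^+ 2).
Proof. by rewrite mink_combl !mink_combr (minkC w v); ring. Qed.

Section DualProjection.
Variables (u v w : 'rV[R]_4).
Hypotheses (uv1 : mink u v = 1) (uw0 : mink u w = 0).
Let D := mink v v * mink w w - mink v w ^+ 2.
Hypothesis D_neq0 : D != 0.

(** Cramer's rule for the Gram system of [v, w] with right-hand side
    [(<u, v>, <u, w>) = (1, 0)]. *)
Let proj := (mink w w / D) *: v + - (mink v w / D) *: w.

Lemma mink_sub_projl : mink (u - proj) v = 0.
Proof.
rewrite minkBl mink_combl uv1 (minkC w v).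
by move: D_neq0; rewrite /D => D0; field.
Qed.

Lemma mink_sub_projr : mink (u - proj) w = 0.
Proof. by rewrite minkBl mink_combl uw0; ring. Qed.

(** Since [u - proj] is orthogonal to [proj], its square is [<u - proj, u>]. *)
Lemma mink_sub_proj_sqr :
  mink (u - proj) (u - proj) = mink u u - mink w w / D.
Proof.
rewrite {1}minkBl [mink proj _]minkC /proj mink_combr -/proj.
rewrite mink_sub_projl mink_sub_projr !mulr0 addr0 subr0 minkC minkBl.
by rewrite /proj mink_combl (minkC v) (minkC w u) uv1 uw0; ring.
Qed.

End DualProjection.

Lemma mink_e1l a b c d : mink e1 (vec4 a b c d) = a.
Proof. by rewrite /mink !mxE /=; ring. Qed.

End Minkowski.

(** * Tangent parts on spacelike surfaces *)

Section SpacelikeDecomposition.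
Set Implicit Arguments.
Unset Strict Implicit.
Context {R : realType} (U : set (R * R)) (psi : R * R -> 'rV[R]_4) (p : R * R).
Hypotheses (psi_spacelike : spacelike U psi) (Up : U p).
Implicit Types (v w : 'rV[R]_4) (a b : R).

Lemma tangent_comb a b : tangent psi p (a *: dx psi p + b *: dy psi p).
Proof. by exists a, b. Qed.

Lemma tangentB v w : tangent psi p v -> tangent psi p w -> tangent psi p (v - w).
Proof.
move=> [a [b ->]] [a' [b' ->]]; exists (a - a'), (b - b').
by rewrite !scalerBl addrACA opprD.
Qed.

Lemma normal_frame w :
  mink w (dx psi p) = 0 -> mink w (dy psi p) = 0 -> normal psi p w.
Proof.
by move=> wx wy t [a [b ->]]; rewrite mink_combr wx wy !mulr0 addr0.
Qed.

(** Two such vectors differ by a vector that is both tangent and normal, hence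
    orthogonal to itself; on a spacelike plane only 0 is. *)
Lemma tangent_normal_unique v w w' :
  tangent psi p w -> normal psi p (v - w) ->
  tangent psi p w' -> normal psi p (v - w') -> w = w'.
Proof.
move=> tw nw tw' nw'; apply/eqP; rewrite -subr_eq0; apply: contraT => ww'.
have tww' := tangentB tw tw'.
suff sqr0 : mink (w - w') (w - w') = 0.
  by have := psi_spacelike Up tww' ww'; rewrite sqr0 ltxx.
have -> : mink (w - w') (w - w') =
    mink (v - w') (w - w') - mink (v - w) (w - w') by rewrite !minkBl; ring.
by rewrite nw// nw'// subr0.
Qed.

Lemma tangent_part_unique v w :
  tangent psi p w -> normal psi p (v - w) -> tangent_part psi v p = w.
Proof.
move=> tw nw; apply: xget_unique => // w' [tw' nw'].
exact: (tangent_normal_unique (v := v)).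
Qed.

Lemma fundG_gt0 : dy psi p != 0 -> 0 < fundG psi p.
Proof.
apply: (psi_spacelike Up).
by exists 0, 1; rewrite scale0r add0r scale1r.
Qed.

Lemma gram_gt0 :
    dy psi p != 0 ->
    fundG psi p *: dx psi p + - fundF psi p *: dy psi p != 0 ->
  0 < fundE psi p * fundG psi p - fundF psi p ^+ 2.
Proof.
move=> /fundG_gt0 G0 /(psi_spacelike Up (tangent_comb _ _)).
by rewrite mink_gram pmulr_rgt0.
Qed.

End SpacelikeDecomposition.

(** * Graphs of pairs of functions *)

Section Graph.
Set Implicit Arguments.
Unset Strict Implicit.
Context {R : realType} (f g : R * R -> R).

Lemma derive_graph_param (p v : R * R) :
    derivable f p v -> derivable g p v ->
  'D_v (graph_param f g) p = vec4 v.1 v.2 ('D_v f p) ('D_v g p).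
Proof.
move=> df dg.
pose dcoord := vec4 v.1 v.2 ('D_v f p) ('D_v g p).
have coord_derive j :
    is_derive p v (fun q => graph_param f g q 0 j) (dcoord 0 j).
  rewrite /graph_param /dcoord.
  under eq_fun do rewrite mxE.
  rewrite mxE; case: j => [[|[|[|[|//]]]] j4] /=.
  - exact: (is_derive_linear (L := fst)).
  - exact: (is_derive_linear (L := snd)).
  - exact: derivableP.
  - exact: derivableP.
rewrite derive_mx; last by apply/derivable_mxP => i j; rewrite ord1.
by apply/rowP => j; rewrite mxE derive_val.
Qed.

Section AtPoint.
Context (U : set (R * R)) (p : R * R).
Let psi := graph_param f g.
Hypotheses (psi_spacelike : spacelike U psi) (Up : U p).
Hypotheses (f_smooth : smooth_on U f) (g_smooth : smooth_on U g).

Lemma dx_graph : dx psi p = vec4 1 0 (dx f p) (dx g p).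
Proof.
have [_ dfx _ _ _] := f_smooth 1%N; have [_ dgx _ _ _] := g_smooth 1%N.
by apply: derive_graph_param; [exact: dfx|exact: dgx].
Qed.

Lemma dy_graph : dy psi p = vec4 0 1 (dy f p) (dy g p).
Proof.
have [_ _ dfy _ _] := f_smooth 1%N; have [_ _ dgy _ _] := g_smooth 1%N.
by apply: derive_graph_param; [exact: dfy|exact: dgy].
Qed.

Lemma mink_e1_dx : mink e1 (dx psi p) = 1.
Proof. by rewrite dx_graph mink_e1l. Qed.

Lemma mink_e1_dy : mink e1 (dy psi p) = 0.
Proof. by rewrite dy_graph mink_e1l. Qed.

Lemma graph_fundG_gt0 : 0 < fundG psi p.
Proof.
apply: (fundG_gt0 _ Up) => //; rewrite dy_graph.
by apply/eqP => /rowP/(_ 1); rewrite !mxE /= => /eqP; rewrite oner_eq0.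
Qed.

Lemma graph_gram_gt0 : 0 < fundE psi p * fundG psi p - fundF psi p ^+ 2.
Proof.
have G0 := graph_fundG_gt0.
apply: (gram_gt0 _ Up) => //.
  apply: contraTneq G0 => dy0.
  by rewrite /fundG dy0 /mink !mxE !mulr0 !addr0 subrr ltxx.
(* The x-coordinate of G psi_x - F psi_y is G. *)
have dx0 : dx psi p 0 0 = 1 by rewrite dx_graph mxE.
have dy0 : dy psi p 0 0 = 0 by rewrite dy_graph mxE.
apply/eqP => /(congr1 (fun w : 'rV[R]_4 => w 0 0)).
rewrite mxE [X in X + _]mxE [X in _ + X]mxE.
rewrite dx0 dy0 mulr1 mulr0 addr0 [RHS]mxE => G_eq0.
by rewrite G_eq0 ltxx in G0.
Qed.

Lemma tangent_part_e1 :
  let D := fundE psi p * fundG psi p - fundF psi p ^+ 2 in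
  tangent_part psi e1 p =
  (fundG psi p / D) *: dx psi p + - (fundF psi p / D) *: dy psi p.
Proof.
move=> D; have D0 : D != 0 by rewrite gt_eqF// graph_gram_gt0.
apply: (tangent_part_unique psi_spacelike Up); first exact: tangent_comb.
apply: normal_frame.
  exact: mink_sub_projl mink_e1_dx D0.
exact: mink_sub_projr mink_e1_dy.
Qed.

Lemma tangent_tangent_part_e1 : tangent psi p (tangent_part psi e1 p).
Proof. by rewrite tangent_part_e1; exact: tangent_comb. Qed.

Lemma normal_part_e1_sqr :
  mink (normal_part psi e1 p) (normal_part psi e1 p) =
  1 - fundG psi p / (fundE psi p * fundG psi p - fundF psi p ^+ 2).
Proof.
have D0 := lt0r_neq0 graph_gram_gt0.
rewrite /normal_part tangent_part_e1.
by rewrite (mink_sub_proj_sqr mink_e1_dx mink_e1_dy D0) mink_e1l.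
Qed.

Lemma normal_part_e1_null :
  mink (normal_part psi e1 p) (normal_part psi e1 p) = 0 <->
  fundE psi p * fundG psi p - fundF psi p ^+ 2 = fundG psi p.
Proof.
have D0 := lt0r_neq0 graph_gram_gt0.
rewrite normal_part_e1_sqr; split=> [/eqP|->].
  rewrite subr_eq0 => /eqP GD.
  by rewrite -[LHS]mul1r GD divfK.
by rewrite divff ?subrr// lt0r_neq0// graph_fundG_gt0.
Qed.

Lemma tangent_part_e1_null :
  fundE psi p * fundG psi p - fundF psi p ^+ 2 = fundG psi p ->
  tangent_part psi e1 p =
  dx psi p - (fundF psi p / fundG psi p) *: dy psi p.
Proof.
move=> DG; rewrite tangent_part_e1 DG scaleNr.
by congr (_ + _); rewrite (divff (lt0r_neq0 graph_fundG_gt0)) scale1r.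
Qed.

End AtPoint.
End Graph.

(** * Canonical normal null directions of graphs *)

Theorem proposition3p2 (R : realType) (U : set (R * R)) (f g : R * R -> R) :
  open U -> smooth_on U f -> smooth_on U g ->
  let psi := graph_param f g in
  let E := fundE psi in let F := fundF psi in let G := fundG psi in
  spacelike U psi ->
  [/\ canonical_normal_null_direction U psi e1 ->
        (forall p, U p -> E p * G p - F p ^+ 2 = G p),
      (* Where e1 is tangent, EG - F^2 = G also holds but e1^perp = 0 is not
         lightlike (take f = g = 0), so the converse needs e1 to be nowhere
         tangent. *)
      (forall p, U p -> ~ tangent psi p e1) ->
        (forall p, U p -> E p * G p - F p ^+ 2 = G p) ->
        canonical_normal_null_direction U psi e1 &
      (forall p, U p -> E p * G p - F p ^+ 2 = G p) ->
        forall p, U p ->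
          tangent_part psi e1 p = dx psi p - (F p / G p) *: dy psi p].
Proof.
move=> _ f_smooth g_smooth psi E F G psi_spacelike; split.
- move=> null p Up; have [_ sqr0] := null p Up.
  exact/(normal_part_e1_null psi_spacelike Up f_smooth g_smooth).
- move=> e1_not_tangent DG p Up; split.
    move=> /eqP; rewrite subr_eq0 => /eqP e1T; apply: (e1_not_tangent p Up).
    by rewrite {}e1T; exact: (tangent_tangent_part_e1 psi_spacelike).
  by apply/(normal_part_e1_null psi_spacelike Up f_smooth g_smooth); exact: DG.
- move=> DG p Up; apply: (tangent_part_e1_null psi_spacelike) => //.
  exact: DG.
Qed.
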